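(* Let $\alpha\in[0,1]$. Let $G_1$ be a $t_1$-regular graph of order $n_1$ and size $m_1$, and let $G_2=K_{a,b}$ be the complete bipartite graph of order $n_2=a+b$. (a) When $t_1=1$, the $A_\alpha$-spectrum of $G_1\dot\vee_T G_2$ comprises: (i) one simple eigenvalue $\alpha(3+n_2)-1$; (ii) one eigenvalue $\alpha(2+a)$ with multiplicity $b-1$; (iii) one eigenvalue $\alpha(2+b)$ with multiplicity $a-1$; and (iv) four eigenvalues obtained by solving the equation $$\begin{aligned}&\big( \nu^2 -(3\alpha +\alpha n_2+1)\nu + 2\alpha^2n_2 +6\alpha -2 \big) \big( \nu^2 -(4\alpha +\alpha n_2)\nu + 4\alpha^2 + 2\alpha^2n_2+2\alpha ab -ab \big)\\ &-2(1-\alpha)^2(\nu-2\alpha) \big( (\nu-2\alpha)n_2 -\alpha n_2^2 + 2ab \big)=0.\end{aligned}$$ (b) When $t_1\ge2$, the $A_\alpha$-spectrum of $G_1\dot\vee_T G_2$ comprises: (i) one eigenvalue $2\alpha(t_1+1)-2$ with multiplicity $m_1-n_1$; (ii) one eigenvalue $\alpha(n_1+a)$ with multiplicity $b-1$; (iii) one eigenvalue $\alpha(n_1+b)$ with multiplicity $a-1$; (iv) the eigenvalues obtained by solving, for each $i=2,3,\ldots,n_1$, the equation $$\begin{aligned}&\nu^2 -\big( \alpha(t_1 +n_2 +2)+t_1 -2 +2\lambda_i(A_{\alpha}(G_1))\big)\nu -(1-\alpha)\big(t_1-2\alpha t_1 + \lambda_i(A_\alpha(G_1))\big)\\ & + \big(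 \alpha t_1 + \alpha n_2 + \lambda_i(A_\alpha(G_1))\big) \big(t_1 -2 +2\alpha +\lambda_i(A_\alpha(G_1)) \big)=0;\end{aligned}$$ and (v) four eigenvalues obtained by solving the equation $$\begin{aligned}&\big( \nu^2 -(\alpha t_1 + \alpha n_2 +3t_1 -2 +2\alpha)\nu + (2\alpha^2 n_2 +2\alpha t_1^2 + 2\alpha t_1 n_2 +4\alpha t_1 -2\alpha n_2 +2t_1^2 -4t_1) \big)\\ &\times\big( \nu^2 -(2\alpha n_1 + \alpha n_2)\nu +( \alpha^2n_1^2 + \alpha^2n_1n_2 +2\alpha ab -ab) \big)\\ &-n_1(1-\alpha)^2(\nu+2-2t_1-2\alpha)\big((\nu-\alpha n_1)n_2 -\alpha n_2^2 +2ab \big)=0.\end{aligned}$$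
   Context: All graphs are undirected and simple. For a graph $G$ with adjacency matrix $A(G)$ and diagonal degree matrix $D(G)$, put $A_\alpha(G)=\alpha D(G)+(1-\alpha)A(G)$. The $A_\alpha$-spectrum of $G$ is the multiset of eigenvalues of $A_\alpha(G)$. Eigenvalues of a symmetric $n\times n$ matrix $M$ are ordered $\lambda_1(M)\ge\cdots\ge\lambda_n(M)$. The order of a graph is its number of vertices and its size is its number of edges. $K_{a,b}$ is the complete bipartite graph with parts of sizes $a$ and $b$. The total graph $T(G)$ is obtained from $G$ (keeping all its vertices and edges) by adding one new vertex for every edge of $G$, making each new vertex adjacent to the two end vertices of the corresponding edge, and making two new vertices adjacent whenever their corresponding (distinct) edges share an endpoint in $G$. The $T$-vertex join $G_1\dot\vee_T G_2$ is obtained from the disjoint union of $T(G_1)$ and $G_2$ by joining each original vertex of $G_1$ in $T(G_1)$ to every vertex of $G_2$.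
   Formalization: Part (a) is stated only for n_1=2 (G_1=K_2): it lists 3+n_2 eigenvalues while the join has 3n_1/2+n_2 vertices, so it fails for every other n_1. Multiplicities, and ''simple'', count contributions to the multiset, as listed values may coincide. *)

(* Defs.v *)
From HB Require Import structures.
From mathcomp Require Import all_boot all_order all_algebra.
From mathcomp.real_closed Require Import polyrcf.

Set Implicit Arguments.
Unset Strict Implicit.
Unset Printing Implicit Defensive.

Import Order.TTheory GRing.Theory Num.Theory.

Local Open Scope ring_scope.

Record sgraph := SGraph {
  vertex :> finType;
  adj : rel vertex;
  adj_sym : symmetric adj;
  adj_irrefl : irreflexive adj
}.

Definition degree (G : sgraph) (x : G) : nat := #|[set y | adj x y]|.

Definition regular (G : sgraph) (t : nat) : Prop := forall x : G, degree x = t.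

Definition edges (G : sgraph) : {set {set G}} :=
  [set [set p.1; p.2] | p : G * G & adj p.1 p.2].

Definition edge (G : sgraph) : finType := {e : {set G} | e \in edges G}.

Definition total_rel (G : sgraph) : rel (G + edge G)%type := fun u v =>
  match u, v with
  | inl x, inl y => adj x y
  | inl x, inr e => x \in val e
  | inr e, inl x => x \in val e
  | inr e, inr f => (e != f) && (val e :&: val f != set0)
  end.

Lemma total_rel_sym (G : sgraph) : symmetric (@total_rel G).
Proof.
by move=> [x|e] [y|f] //=; [exact: adj_sym | rewrite eq_sym setIC].
Qed.

Lemma total_rel_irrefl (G : sgraph) : irreflexive (@total_rel G).
Proof. by move=> [x|e] /=; [exact: adj_irrefl | rewrite eqxx]. Qed.

Definition total_graph (G : sgraph) : sgraph :=
  SGraph (@total_rel_sym G) (@total_rel_irrefl G).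

Definition tvjoin_rel (G1 G2 : sgraph) : rel (total_graph G1 + G2)%type :=
  fun u v =>
  match u, v with
  | inl p, inl q => adj p q
  | inr y, inr z => adj y z
  | inl p, inr _ | inr _, inl p => if p is inl _ then true else false
  end.

Lemma tvjoin_rel_sym (G1 G2 : sgraph) : symmetric (@tvjoin_rel G1 G2).
Proof.
move=> [p|y] [q|z]; [| by [] | by [] |].
- exact: (@adj_sym (total_graph G1)).
- exact: (@adj_sym G2).
Qed.

Lemma tvjoin_rel_irrefl (G1 G2 : sgraph) : irreflexive (@tvjoin_rel G1 G2).
Proof. by move=> [p|y]; [exact: (@adj_irrefl (total_graph G1)) | exact: (@adj_irrefl G2)]. Qed.

Definition tvjoin (G1 G2 : sgraph) : sgraph :=
  SGraph (@tvjoin_rel_sym G1 G2) (@tvjoin_rel_irrefl G1 G2).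

Definition bip_rel (a b : nat) : rel ('I_a + 'I_b)%type := fun u v =>
  match u, v with
  | inl _, inr _ | inr _, inl _ => true
  | inl _, inl _ | inr _, inr _ => false
  end.

Lemma bip_rel_sym (a b : nat) : symmetric (@bip_rel a b).
Proof. by move=> [x|x] [y|y]. Qed.

Lemma bip_rel_irrefl (a b : nat) : irreflexive (@bip_rel a b).
Proof. by move=> [x|x]. Qed.

Definition complete_bipartite (a b : nat) : sgraph :=
  SGraph (@bip_rel_sym a b) (@bip_rel_irrefl a b).

Definition adjmx (R : nzRingType) (G : sgraph) : 'M[R]_#|G| :=
  \matrix_(i, j) (adj (enum_val i) (enum_val j))%:R.

Definition degmx (R : nzRingType) (G : sgraph) : 'M[R]_#|G| :=
  diag_mx (\row_i (degree (enum_val i))%:R).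

Definition Aalpha (R : nzRingType) (alpha : R) (G : sgraph) : 'M[R]_#|G| :=
  alpha *: degmx R G + (1 - alpha) *: adjmx R G.

(* The multiset of roots in R of p, each one listed as often as its
   multiplicity; it is empty for p = 0. *)
Definition root_multiset (R : rcfType) (p : {poly R}) : seq R :=
  flatten [seq nseq (mup x p) x | x <- rootsR p].

(* Over a real closed field a symmetric matrix of order n has n eigenvalues
   in R, so for such matrices no eigenvalue is lost here. *)
Definition spectrum (R : rcfType) (n : nat) (M : 'M[R]_n) : seq R :=
  root_multiset (char_poly M).

(* The i-th largest eigenvalue, counted from i = 1 to n (junk value 0 outside
   this range, except that i = 0 gives the largest one). *)
Definition eigval (R : rcfType) (n : nat) (M : 'M[R]_n) (i : nat) : R :=
  nth 0 (sort (fun x y : R => y <= x) (spectrum M)) i.-1.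

(* Main.v *)
Require Import Defs.
From HB Require Import structures.
From mathcomp Require Import all_boot all_order all_algebra.
From mathcomp Require Import perm spectral ring.
From mathcomp.real_closed Require Import polyrcf complex.

Set Implicit Arguments.
Unset Strict Implicit.
Unset Printing Implicit Defensive.

Import Order.TTheory GRing.Theory Num.Theory.

Local Open Scope ring_scope.

(** Write the matrix [x I - A_alpha] of the join as [D + U S U^T], where [U] is the
indicator matrix of the four vertex classes (vertices of [G1], edges of [G1], the
two sides of [K_{a,b}]) and [D] has no entries between [T(G1)], the first side and
the second side. As [G1] is regular, the classes are equitable for [D]: [D U = U Q]
with [Q] of order 4, whence [det (D + U S U^T) det Q = det D det (Q + S U^T U)], and
the last factor is the quartic. In the block of [T(G1)] the incidence matrix [B]
satisfies [B B^T = A + t I], so eliminating the edge rows leaves the determinant of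
a quadratic polynomial in [L = A_alpha(G1)], which is a product over the
eigenvalues of [L]. The factor at the largest eigenvalue [t] cancels [det Q]. *)

(** * Polynomials and root multisets *)

(** A nonzero difference [r] would vanish at [size r] distinct naturals, one more than its degree
    allows. Polynomial identities can thus be checked pointwise. *)
Lemma poly_ext (R : numDomainType) (p q : {poly R}) :
  (forall x, p.[x] = q.[x]) -> p = q.
Proof.
move=> eq_pq; apply/eqP; rewrite -subr_eq0; set r := p - q.
apply/contraT => nz; pose rs := [seq i%:R : R | i <- iota 0 (size r)].
suff: (size rs < size r)%N by rewrite size_map size_iota ltnn.
apply: max_poly_roots => //.
  by apply/allP => _ /mapP[i _ ->]; rewrite rootE !hornerE eq_pq subrr.
by rewrite map_inj_uniq ?iota_uniq //; apply: mulrIn; rewrite oner_eq0.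
Qed.

Lemma horner_char_poly (R : comNzRingType) n (A : 'M[R]_n) x :
  (char_poly A).[x] = \det (x%:M - A).
Proof.
rewrite -horner_evalE /char_poly -det_map_mx; congr (\det _).
apply/matrixP => i j; rewrite !mxE /= /horner_eval hornerD hornerN hornerMn hornerX hornerC.
by [].
Qed.

Section RootMultiset.
Variable R : rcfType.
Implicit Types p q : {poly R}.

(** [rootsR p] has no repetition, so only the block of [x] contributes; when [x] is not a root, both
    sides are 0. *)
Lemma count_root_multiset p x :
  p != 0 -> count_mem x (root_multiset p) = mup x p.
Proof.
move=> nz; have uniq_r : uniq (rootsR p).
  exact: (sorted_uniq lt_trans ltxx (sorted_roots _ _ _)).
rewrite /root_multiset count_flatten -map_comp sumnE big_map.
under eq_bigr => y _ do rewrite /= count_nseq /=.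
have mem_r : (x \in rootsR p) = root p x.
  by have /(_ x) := roots_on_rootsR nz; rewrite in_itv.
case: (boolP (x \in rootsR p)) => xr.
  rewrite (bigD1_seq x) //= eqxx mul1n big1 ?addn0 // => y ne.
  by rewrite (negPf ne).
rewrite mupNroot -?mem_r // big_seq big1 // => y yr.
by case: eqP => // yx; rewrite -yx yr in xr.
Qed.

Lemma root_multisetM p q : p != 0 -> q != 0 ->
  perm_eq (root_multiset (p * q)) (root_multiset p ++ root_multiset q).
Proof.
move=> p0 q0; apply/allP => x _; apply/eqP => /=.
by rewrite count_cat !count_root_multiset ?mulf_neq0 // mupM.
Qed.

Lemma root_multiset_prod_XsubC (s : seq R) :
  perm_eq (root_multiset (\prod_(x <- s) ('X - x%:P))) s.
Proof.
apply/allP => x _; apply/eqP => /=.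
by rewrite count_root_multiset ?mu_prod_XsubC ?monic_neq0 ?monic_prod_XsubC.
Qed.

Lemma root_multiset_eqp p q : p %= q ->
  perm_eq (root_multiset p) (root_multiset q).
Proof.
have [->|q0] := eqVneq q 0; first by rewrite eqp0 => /eqP->.
case/eqpf_eq=> c c0 ->; rewrite -mul_polyC.
apply/allP => x _; apply/eqP => /=; rewrite !count_root_multiset //.
  by rewrite mupMr // rootC.
by rewrite mulf_neq0 ?polyC_eq0.
Qed.

Lemma root_multiset_prod I (s : seq I) (F : I -> {poly R}) :
  (forall i, F i != 0) ->
  perm_eq (root_multiset (\prod_(i <- s) F i))
          (flatten [seq root_multiset (F i) | i <- s]).
Proof.
move=> nz; elim: s => [|i s IHs] /=.
  by rewrite big_nil /root_multiset -[1]/(1%:P) rootsRC.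
rewrite big_cons; apply: perm_trans (root_multisetM _ _) _ => //.
  by rewrite prodf_seq_neq0 (eq_all (a2 := predT)) ?all_predT // => j; rewrite nz.
by rewrite perm_cat2l.
Qed.

Lemma root_multiset_XsubC_exp (x : R) k :
  perm_eq (root_multiset (('X - x%:P) ^+ k)) (nseq k x).
Proof.
rewrite (_ : _ ^+ k = \prod_(y <- nseq k x) ('X - y%:P)) ?root_multiset_prod_XsubC //.
by rewrite big_nseq -Monoid.iteropE.
Qed.

Lemma root_multiset_XsubC_expM (x : R) k p s : p != 0 ->
  perm_eq (root_multiset p) s ->
  perm_eq (root_multiset (('X - x%:P) ^+ k * p)) (nseq k x ++ s).
Proof.
move=> p0 eq_s; have xk0 : ('X - x%:P) ^+ k != 0 by rewrite expf_neq0 ?polyXsubC_eq0.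
apply: perm_trans (root_multisetM xk0 p0) _.
by apply: perm_cat => //; apply: root_multiset_XsubC_exp.
Qed.

(** A divisor of a product of linear factors is, up to a nonzero constant, a subproduct of it, so it
    splits too. *)
Lemma size_root_multiset_dvdp p (s : seq R) :
  p %| \prod_(x <- s) ('X - x%:P) -> size (root_multiset p) = (size p).-1.
Proof.
case/dvdp_prod_XsubC=> m eq_p; rewrite (eqp_size eq_p) size_prod_XsubC /=.
apply: perm_size; apply: perm_trans (root_multiset_eqp eq_p) _.
exact: root_multiset_prod_XsubC.
Qed.

End RootMultiset.

(** * Spectra of real symmetric matrices *)

(** Over [R[i]] the matrix is hermitian and the spectral theorem for normal matrices applies. Its
    eigenvalues are real, so [d] can be taken over [R] although [P] is complex. *)
Lemma sym_diagonalizable (R : rcfType) n (A : 'M[R]_n) : A^T = A ->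
  exists d : 'rV[R]_n, exists2 P : 'M[R[i]]_n, P \in unitmx &
    map_mx (real_complex R) A
      = invmx P *m diag_mx (map_mx (real_complex R) d) *m P.
Proof.
move=> symA; pose A' := map_mx (real_complex R) A.
have hermA : A' \is hermsymmx.
  apply: realsym_hermsym.
    by apply/is_hermitianmxP; rewrite expr0 scale1r map_mx_id // map_trmx symA.
  by apply/mxOverP => i j; rewrite mxE complex_real.
have /orthomx_spectralP eqA := hermitian_normalmx hermA.
exists (map_mx (@complex.Re R) (spectral_diag A')).
exists (spectralmx A'); first exact: unitarymx_unit (spectral_unitarymx _).
have -> : map_mx (real_complex R) (map_mx (@complex.Re R) (spectral_diag A'))
    = spectral_diag A'.
  apply/rowP => j; rewrite !mxE.
  have /mxOverP/(_ 0 j) dreal := hermitian_spectral_diag_real hermA.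
  by rewrite [RHS]complexE (RIm_real dreal) mulr0 addr0.
exact: eqA.
Qed.

Lemma det_quadratic_diag (F : fieldType) n (P A : 'M[F]_n) (d : 'rV[F]_n)
    (a0 a1 a2 : F) :
  P \in unitmx -> A = invmx P *m diag_mx d *m P ->
  \det (a0%:M + a1 *: A + a2 *: (A *m A))
    = \prod_i (a0 + a1 * d 0 i + a2 * d 0 i ^+ 2).
Proof.
move=> uP eqA; pose e := \row_i (a0 + a1 * d 0 i + a2 * d 0 i ^+ 2).
have -> : a0%:M + a1 *: A + a2 *: (A *m A) = invmx P *m diag_mx e *m P.
  have -> : diag_mx e = a0%:M + a1 *: diag_mx d + a2 *: (diag_mx d *m diag_mx d).
    apply/matrixP => i j; rewrite mulmx_diag !mxE.
    by case: eqP => _; rewrite ?mulr1n // !mulr0n !mulr0 !addr0.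
  rewrite !mulmxDr !mulmxDl mul_mx_scalar -!scalemxAr -!scalemxAl mulVmx //.
  rewrite scalemx1 eqA; congr (_ + _ *: _).
  by rewrite !mulmxA -(mulmxA (invmx P *m diag_mx d) P) mulmxV // mulmx1.
rewrite !det_mulmx det_inv mulrAC mulVf ?mul1r -?unitfE -?unitmxE //.
by rewrite det_diag; apply: eq_bigr => i _; rewrite !mxE.
Qed.

(** The determinant is computed in [R[i]] after diagonalization, and the equality descends because
    the embedding of [R] is injective. *)
Lemma sym_det_quadratic (R : rcfType) n (A : 'M[R]_n) : A^T = A ->
  exists2 s : seq R, size s = n & forall a0 a1 a2 : R,
    \det (a0%:M + a1 *: A + a2 *: (A *m A))
      = \prod_(l <- s) (a0 + a1 * l + a2 * l ^+ 2).
Proof.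
move=> /sym_diagonalizable[d [P uP eqA]].
exists [seq d 0 i | i <- enum 'I_n]; first by rewrite size_map size_enum_ord.
move=> a0 a1 a2; rewrite big_map big_enum /=.
apply: (@complexI R); rewrite -det_map_mx rmorph_prod.
rewrite !(map_mxD, map_mxZ, map_mxM, map_scalar_mx) (det_quadratic_diag _ _ _ uP eqA).
by apply: eq_bigr => i _; rewrite mxE !(rmorphD, rmorphM).
Qed.

(** The coefficients [x], [-1], [0] turn the quadratic into [x - A]; hence the list [s] of diagonal
    entries is the spectrum up to order. *)
Lemma sym_spectrum (R : rcfType) n (A : 'M[R]_n) : A^T = A ->
  [/\ size (spectrum A) = n,
      char_poly A = \prod_(l <- spectrum A) ('X - l%:P)
    & forall a0 a1 a2 : R, \det (a0%:M + a1 *: A + a2 *: (A *m A))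
        = \prod_(l <- spectrum A) (a0 + a1 * l + a2 * l ^+ 2)].
Proof.
move=> /sym_det_quadratic[s size_s detA].
have charA : char_poly A = \prod_(l <- s) ('X - l%:P).
  apply: poly_ext => x; rewrite horner_char_poly horner_prod.
  have := detA x (-1) 0; rewrite scale0r addr0 scaleN1r => ->.
  by apply: eq_bigr => l _; rewrite !hornerE; ring.
have perm_s : perm_eq (spectrum A) s.
  by rewrite /spectrum charA root_multiset_prod_XsubC.
split; first by rewrite (perm_size perm_s).
  by rewrite charA (perm_big _ perm_s).
by move=> a0 a1 a2; rewrite detA (perm_big _ perm_s).
Qed.

(** Compare both sides of the eigenvector equation at a coordinate [j] where [v] is largest in
    absolute value. Eigenvectors are rows here, whence column sums. *)
Lemma eigenvalue_le_colsum (R : realFieldType) n (A : 'M[R]_n) (t l : R) :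
  (forall i j, 0 <= A i j) -> (forall j, \sum_i A i j = t) ->
  eigenvalue A l -> l <= t.
Proof.
move=> A0 sumA /eigenvalueP[v eq_v nz_v].
have [j0 nz_j0] : exists j, v 0 j != 0 by apply/rV0Pn.
pose j := [arg max_(k > j0) `|v 0 k|]%O.
have max_j k : `|v 0 k| <= `|v 0 j|.
  by rewrite /j; case: arg_maxP => // i _ /(_ k isT).
have gt0 : 0 < `|v 0 j| by apply: lt_le_trans (max_j j0); rewrite normr_gt0.
rewrite -(ler_pM2r gt0); apply: le_trans (_ : `|l * v 0 j| <= _).
  by rewrite normrM ler_wpM2r ?ler_norm.
have /rowP/(_ j) := eq_v; rewrite !mxE => <-.
apply: le_trans (ler_norm_sum _ _ _) _; rewrite -(sumA j) mulr_suml.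
apply: ler_sum => i _; rewrite normrM mulrC (ger0_norm (A0 _ _)).
by rewrite ler_wpM2l.
Qed.

(** * Determinant identities *)

(** Right multiplication by a lower triangular block matrix of determinant [c ^+ m] clears the lower
    left block. The powers of [c] stand on both sides so that [c] need not be invertible. *)
Lemma det_block_scalar (R : comNzRingType) m n (A : 'M[R]_m) (B : 'M[R]_(m, n))
    (C : 'M[R]_(n, m)) (c : R) :
  \det (block_mx A B C c%:M) * c ^+ m = \det (c *: A - B *m C) * c ^+ n.
Proof.
have := det_mulmx (block_mx A B C c%:M) (block_mx c%:M 0 (- C) 1%:M).
rewrite mulmx_block det_lblock det_scalar det1 mulr1 => <-.
rewrite !mulmx0 !mulmx1 !add0r mul_mx_scalar mul_mx_scalar mul_scalar_mx.
by rewrite scalerN subrr mulmxN det_ublock det_scalar.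
Qed.

(* Subtracting from the second block row the multiple [B^T] of the first one
   turns the lower right block into a scalar matrix. *)
Lemma det_incidence_block (R : comNzRingType) m n (L : 'M[R]_m)
    (B : 'M[R]_(m, n)) (be c y : R) :
  \det (block_mx (y%:M - L) (- (be *: B)) (- (be *: B^T))
          (c%:M - be *: (B^T *m B))) * c ^+ m
    = \det (c *: (y%:M - L) - be *: (B *m B^T) *m ((be + y)%:M - L)) * c ^+ n.
Proof.
set X := block_mx _ _ _ _.
have := det_mulmx (block_mx 1%:M 0 (- B^T) 1%:M) X.
rewrite det_lblock !det1 !mul1r => <-.
rewrite /X mulmx_block !mul1mx !mul0mx !addr0.
have -> : - B^T *m - (be *: B) + (c%:M - be *: (B^T *m B)) = c%:M.
  by rewrite mulNmx mulmxN opprK -scalemxAr addrC subrK.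
have -> : - B^T *m (y%:M - L) + - (be *: B^T) = - (B^T *m ((be + y)%:M - L)).
  rewrite mulNmx -opprD; congr (- _).
  by rewrite addrC -mul_mx_scalar -mulmxDr addrA -raddfD.
by rewrite det_block_scalar mulNmx mulmxN opprK -!scalemxAl mulmxA.
Qed.

(** The bordered matrix [X] has determinant [\det (D + U *m Y)] by one triangular multiplication. A
    second one, with [U] and [Q] as its right block column, produces the zero block
    [D *m U - U *m Q]. *)
Lemma det_intertwined_update (R : comNzRingType) n k (D : 'M[R]_n)
    (U : 'M[R]_(n, k)) (Y : 'M[R]_(k, n)) (Q : 'M[R]_k) :
  D *m U = U *m Q -> \det (D + U *m Y) * \det Q = \det D * \det (Q + Y *m U).
Proof.
move=> DU; pose X := block_mx D (- U) Y 1%:M.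
have <- : \det X = \det (D + U *m Y).
  have := det_mulmx X (block_mx 1%:M 0 (- Y) 1%:M).
  rewrite mulmx_block det_lblock !det1 !mulr1 => <-.
  by rewrite !mulmx1 !mulmx0 !mul1mx !add0r subrr mulNmx mulmxN opprK det_ublock det1 mulr1.
have := det_mulmx X (block_mx 1%:M U 0 Q).
rewrite mulmx_block det_ublock !det1 !mul1r => <-.
by rewrite !mulmx1 !mulmx0 !addr0 mul1mx mulNmx DU subrr det_lblock addrC.
Qed.

(** * Matrices indexed by finite types *)

Section FunMatrix.
Variable R : comNzRingType.

Definition fun_mx (T1 T2 : finType) (F : T1 -> T2 -> R) : 'M[R]_(#|T1|, #|T2|) :=
  \matrix_(i, j) F (enum_val i) (enum_val j).

Lemma sum_enum_val (T : finType) (F : T -> R) :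
  \sum_(i < #|T|) F (enum_val i) = \sum_x F x.
Proof.
by rewrite (reindex (@enum_val T predT)) //; apply: onW_bij; apply: enum_val_bij.
Qed.

Lemma eq_fun_mx (T1 T2 : finType) (F G : T1 -> T2 -> R) :
  (forall x y, F x y = G x y) -> fun_mx F = fun_mx G.
Proof. by move=> eqFG; apply/matrixP => i j; rewrite !mxE. Qed.

Lemma mul_fun_mx (T1 T2 T3 : finType) (F : T1 -> T2 -> R) (G : T2 -> T3 -> R) :
  fun_mx F *m fun_mx G = fun_mx (fun x z => \sum_y F x y * G y z).
Proof.
apply/matrixP => i k; rewrite !mxE -[RHS]sum_enum_val.
by apply: eq_bigr => j _; rewrite !mxE.
Qed.

(** Two enumerations of [T] differ by a permutation [s] acting on rows and columns alike, so its
    sign occurs twice and cancels. *)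
Lemma det_fun_mx_bij (T : finType) n (h : 'I_n -> T) (F : T -> T -> R) :
  bijective h -> \det (\matrix_(i, j) F (h i) (h j)) = \det (fun_mx F).
Proof.
move=> bij_h; have nT : n = #|T| by rewrite -(bij_eq_card bij_h) card_ord.
move: h bij_h; rewrite nT => h /bij_inj inj_h.
have inj_s : injective (enum_rank \o h) by apply: inj_comp => //; apply: enum_rank_inj.
pose s := perm inj_s.
have -> : \matrix_(i, j) F (h i) (h j) = row_perm s (col_perm s (fun_mx F)).
  by apply/matrixP => i j; rewrite !mxE !permE /= !enum_rankK.
rewrite row_permE col_permE !det_mulmx !det_perm odd_permV mulrCA -signr_addb.
by rewrite addbb mulr1.
Qed.

Lemma det_fun_mx_sum (T1 T2 : finType) (F : T1 + T2 -> T1 + T2 -> R) :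
  \det (fun_mx F)
    = \det (block_mx (fun_mx (fun x y => F (inl x) (inl y)))
                     (fun_mx (fun x y => F (inl x) (inr y)))
                     (fun_mx (fun x y => F (inr x) (inl y)))
                     (fun_mx (fun x y => F (inr x) (inr y)))).
Proof.
pose h (k : 'I_(#|T1| + #|T2|)) : T1 + T2 :=
  match split k with inl i => inl (enum_val i) | inr i => inr (enum_val i) end.
pose g (x : T1 + T2) : 'I_(#|T1| + #|T2|) :=
  match x with inl x => lshift _ (enum_rank x) | inr x => rshift _ (enum_rank x) end.
have hl i : h (lshift _ i) = inl (enum_val i) by rewrite /h (unsplitK (inl i)).
have hr i : h (rshift _ i) = inr (enum_val i) by rewrite /h (unsplitK (inr i)).
have bij_h : bijective h.
  exists g => [k|[x|x]]; last by rewrite hr enum_rankK.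
    by case: (split_ordP k) => i ->; rewrite (hl, hr) /= enum_valK.
  by rewrite hl enum_rankK.
rewrite -(det_fun_mx_bij _ bij_h); congr (\det _).
apply/matrixP => i j; case: (split_ordP i) => {}i ->; case: (split_ordP j) => {}j ->;
by rewrite ?(block_mxEul, block_mxEur, block_mxEdl, block_mxEdr) !mxE ?hl ?hr.
Qed.

Lemma det_fun_mx_scalar (T : finType) (c : R) :
  \det (fun_mx (fun x y : T => c *+ (x == y))) = c ^+ #|T|.
Proof.
rewrite -det_scalar; congr (\det _); apply/matrixP => i j.
by rewrite !mxE (inj_eq enum_val_inj).
Qed.

(** With [U] the indicator matrix of the classes, the hypothesis reads [D U = U Q], the added term
    is [U S U^T], and [U^T U] is the diagonal matrix of class sizes. *)
Lemma det_equitable (T : finType) k (cls : T -> 'I_k) (D : T -> T -> R)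
    (Q S : 'M[R]_k) :
  (forall x j, \sum_(y | cls y == j) D x y = Q (cls x) j) ->
  \det (fun_mx (fun x y => D x y + S (cls x) (cls y))) * \det Q
    = \det (fun_mx D)
      * \det (\matrix_(i, j) (Q i j + S i j * #|[pred x | cls x == j]|%:R)).
Proof.
move=> eqQ.
pose U : 'M[R]_(#|T|, k) := \matrix_(i, j) (cls (enum_val i) == j)%:R.
have sel (F : 'I_k -> R) j : \sum_i F i * (j == i)%:R = F j.
  rewrite (bigD1 j) //= eqxx mulr1 big1 ?addr0 // => i ne.
  by rewrite eq_sym (negPf ne) mulr0.
have DU : fun_mx D *m U = U *m Q.
  apply/matrixP => i j; rewrite !mxE.
  under [RHS]eq_bigr => l _ do rewrite mxE mulrC.
  rewrite (sel (fun l => Q l j)) -eqQ [RHS]big_mkcond -[RHS]sum_enum_val.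
  by apply: eq_bigr => l _; rewrite !mxE; case: eqP => _; rewrite ?mulr1 ?mulr0.
have <- : fun_mx D + U *m (S *m U^T)
    = fun_mx (fun x y => D x y + S (cls x) (cls y)).
  apply/matrixP => i j; rewrite !mxE; congr (_ + _).
  under eq_bigr => l _ do rewrite !mxE mulrC.
  rewrite (sel (fun l => \sum_p S l p * U^T p j)).
  by under eq_bigr => l _ do rewrite !mxE; rewrite sel.
rewrite det_intertwined_update // -mulmxA; congr (_ * \det _).
apply/matrixP => i j; rewrite [LHS]mxE [RHS]mxE; congr (_ + _).
rewrite mxE (bigD1 j) //= [X in _ + X]big1 ?addr0.
  congr (_ * _); rewrite mxE -[in RHS]sum1_card natr_sum [RHS]big_mkcond.
  rewrite -[RHS]sum_enum_val.
  by apply: eq_bigr => l _; rewrite !mxE inE; case: eqP => _; rewrite ?mulr1 ?mulr0.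
move=> l ne; rewrite mxE big1 ?mulr0 // => p _; rewrite !mxE.
by case: eqP => [->|_]; rewrite ?mul0r // (negPf ne) mulr0.
Qed.

End FunMatrix.

(** * Vertices and edges of a regular graph *)

Section Graph.
Variable G : sgraph.
Local Open Scope nat_scope.
Implicit Types (x y : G) (e f : edge G).

Lemma card_edges : #|edge G| = #|edges G|.
Proof. by rewrite card_sig; apply: eq_card => e; rewrite inE. Qed.

Lemma edgeP e : exists x y, [/\ adj x y, x != y & val e = [set x; y]].
Proof.
have /imsetP[[x y]] := valP e; rewrite inE /= => xy ->.
exists x, y; split=> //; apply: contraTneq xy => ->.
by rewrite adj_irrefl.
Qed.

Lemma card_edge e : #|val e| = 2.
Proof. by have [x [y [_ ne ->]]] := edgeP e; rewrite cards2 ne. Qed.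

Lemma edge_ends e x y : x != y -> x \in val e -> y \in val e ->
  val e = [set x; y].
Proof.
move=> ne xe ye; apply/esym/eqP; rewrite eqEcard cards2 ne card_edge leqnn andbT.
by apply/subsetP => z; rewrite !inE => /orP[] /eqP->.
Qed.

Lemma adj_edge e x y : x != y -> x \in val e -> y \in val e -> adj x y.
Proof.
move=> ne xe ye; have [u [v [uv _ eqe]]] := edgeP e.
move: xe ye ne; rewrite eqe !inE => /orP[] /eqP-> /orP[] /eqP->;
by rewrite ?eqxx // adj_sym.
Qed.

(** Distinct edges share at most one vertex, so the intersection has size 2, 1 or 0. This is the
    entry of [B^T B], which is twice the identity plus the adjacency matrix of the line graph. *)
Lemma card_edgeI e f :
  #|val e :&: val f| = (e == f).*2 + ((e != f) && (val e :&: val f != set0)).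
Proof.
have [->|ne] /= := eqVneq e f; first by rewrite setIid card_edge.
have : #|val e :&: val f| < 2.
  rewrite -(card_edge e) ltn_neqAle subset_leq_card ?subsetIl // andbT.
  apply: contraNneq ne => eqc.
  have /eqP/setIidPl sub_ef : val e :&: val f == val e.
    by rewrite eqEcard subsetIl eqc leqnn.
  by apply/eqP/val_inj/eqP; rewrite eqEcard sub_ef !card_edge.
by rewrite -cards_eq0; case: #|_| => [|[|]].
Qed.

Lemma degree_sum x : degree x = \sum_y adj x y.
Proof.
rewrite /degree -sum1_card big_mkcond; apply: eq_bigr => y _.
by rewrite inE; case: adj.
Qed.

(** The only edge that can contain both vertices is [[set x; y]]. These are the off-diagonal entries
    of [B B^T]. *)
Lemma sum_common_edges x y : x != y ->
  \sum_(e : edge G) (x \in val e) * (y \in val e) = adj x y.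
Proof.
move=> ne; case: (boolP (adj x y)) => [xy|nxy]; last first.
  apply: big1 => e _; case: (boolP (x \in val e)) => // xe.
  case: (boolP (y \in val e)) => // ye.
  by rewrite (adj_edge ne xe ye) in nxy.
have xyE : [set x; y] \in edges G by apply/imsetP; exists (x, y) => //; rewrite inE.
pose e0 : edge G := exist (fun e : {set G} => e \in edges G) _ xyE.
rewrite (bigD1 e0) //= !inE !eqxx orbT /= big1 // => e nee.
case: (boolP (x \in val e)) => // xe; case: (boolP (y \in val e)) => // ye.
by case/eqP: nee; apply: val_inj; rewrite /= (edge_ends ne xe ye).
Qed.

(** Each edge at [x] has exactly one other end; summing over that end first reduces the count to
    [sum_common_edges]. *)
Lemma sum_edges_at x : \sum_(e : edge G) (x \in val e) = degree x.
Proof.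
have eqs e : (x \in val e : nat) = \sum_(y | x != y) (x \in val e) * (y \in val e).
  rewrite -big_distrr /=; case: (boolP (x \in val e)) => // xe; rewrite mul1n.
  have cardD : #|[predD1 val e & x]| = 1.
    by have := card_edge e; rewrite (cardD1 x) xe => -[].
  apply: etrans (esym cardD) _; rewrite -sum1_card big_mkcond [RHS]big_mkcond; apply: eq_bigr => y _.
  by rewrite inE eq_sym; case: eqP => //=; case: (y \in _).
rewrite (eq_bigr _ (fun e _ => eqs e)) exchange_big degree_sum [RHS](bigD1 x) //=.
rewrite adj_irrefl add0n; apply: eq_big => y; rewrite eq_sym // => ne.
by rewrite sum_common_edges // eq_sym.
Qed.

Lemma sum_edge e : \sum_x (x \in val e) = 2.
Proof.
by rewrite -(card_edge e) -sum1_card [RHS]big_mkcond; apply: eq_bigr => x _; case: ifP.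
Qed.

Lemma sum_edgeI e f : \sum_x (x \in val e) * (x \in val f) = #|val e :&: val f|.
Proof.
rewrite -sum1_card [RHS]big_mkcond; apply: eq_bigr => x _.
by rewrite inE; do 2!case: (x \in _).
Qed.

Variable t : nat.
Hypothesis regG : regular G t.

(** Double counting: each of the two ends of [e] lies on [t] edges. *)
Lemma sum_card_edgeI e : \sum_(f : edge G) #|val e :&: val f| = t.*2.
Proof.
under eq_bigr => f _ do rewrite -sum_edgeI.
rewrite exchange_big /= -muln2 mulnC -[in RHS](sum_edge e) big_distrl /=.
by apply: eq_bigr => x _; rewrite -big_distrr /= sum_edges_at regG.
Qed.

Lemma handshake : #|G| * t = #|edges G|.*2.
Proof.
rewrite -card_edges -muln2 -!sum_nat_const; under [RHS]eq_bigr => e _ do rewrite -(sum_edge e).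
by rewrite exchange_big; apply: eq_bigr => x _; rewrite sum_edges_at regG.
Qed.

End Graph.

(** * Degrees in the join *)

Section Join.
Variables (G : sgraph) (t a b : nat).
Hypothesis regG : regular G t.
Local Open Scope nat_scope.
Let J := tvjoin G (complete_bipartite a b).

Lemma degree_join_vertex x : @degree J (inl (inl x)) = t.*2 + (a + b).
Proof.
rewrite degree_sum big_sumType big_sumType big_sumType /= sum_edges_at regG.
by rewrite -degree_sum regG !sum1_card !card_ord addnn.
Qed.

(** In [sum_card_edgeI] the term [f = e] counts 2, which matches the two ends of [e]; the other
    terms count the adjacent edges. *)
Lemma degree_join_edge e : @degree J (inl (inr e)) = t.*2.
Proof.
rewrite degree_sum big_sumType big_sumType big_sumType /= !big1_eq !addn0 sum_edge.
rewrite -(sum_card_edgeI regG e); under [RHS]eq_bigr => f _ do rewrite card_edgeI.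
rewrite big_split /=; congr (_ + _).
by rewrite (bigD1 e) //= eqxx big1 // => f ne; rewrite eq_sym (negPf ne).
Qed.

Lemma degree_join_left i : @degree J (inr (inl i)) = #|G| + b.
Proof.
rewrite degree_sum big_sumType big_sumType big_sumType /= !big1_eq !addn0.
by rewrite !sum1_card card_ord.
Qed.

Lemma degree_join_right i : @degree J (inr (inr i)) = #|G| + a.
Proof.
rewrite degree_sum big_sumType big_sumType big_sumType /= !big1_eq !addn0.
by rewrite !sum1_card card_ord.
Qed.

End Join.

(** * The matrix of the join *)

(* Unlike [expand_det_row], this expansion computes when [n] is a numeral and the
   entries of [f] are read off a list. *)
Fixpoint laplace (R : comNzRingType) n (f : nat -> nat -> R) : R :=
  if n is n'.+1 then
    \sum_(j < n) (-1) ^+ j * f 0%N j * laplace n' (fun i k => f i.+1 (bump j k))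
  else 1.

Lemma det_laplace (R : comNzRingType) n (f : nat -> nat -> R) :
  \det (\matrix_(i < n, j < n) f i j) = laplace n f.
Proof.
elim: n f => [|n IHn] f; first by rewrite det_mx00.
rewrite [RHS]/= (expand_det_row _ ord0); apply: eq_bigr => j _.
rewrite /cofactor !mxE add0n mulrA [f _ _ * _]mulrC -IHn; congr (_ * \det _).
by apply/matrixP => i k; rewrite !mxE.
Qed.

Section JoinMatrix.
Variables (R : comNzRingType) (al x : R) (G : sgraph) (t a b : nat).
Hypothesis regG : regular G t.
Let J := tvjoin G (complete_bipartite a b).
Let n := #|G|.
Let m := #|edge G|.
Let be := 1 - al.
Let tr : R := t%:R.
Let N : R := (a + b)%:R.
Let y := x - al * (tr + N).
Let c := x - 2 * al * tr + 2 * be.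
Let p := x - al * (n%:R + b%:R).
Let q := x - al * (n%:R + a%:R).
Let k := (1 - 2 * al) * tr.
Let L := Aalpha al G.
Let B : 'M[R]_(n, m) := fun_mx (fun (v : G) (e : edge G) => (v \in val e)%:R).

Lemma scalar_sub_Aalpha (H : sgraph) :
  x%:M - Aalpha al H
    = fun_mx (fun u v : H => (x - al * (degree u)%:R) *+ (u == v)
                             - be * (adj u v)%:R).
Proof.
apply/matrixP => i j; rewrite !mxE (inj_eq enum_val_inj) opprD addrA.
by case: eqP => _; rewrite ?mulr1n // !mulr0n mulr0 subr0.
Qed.

(** By [B B^T = A + t I] and [L = al t I + be A], the two sides differ by the scalar [(be - al) t],
    which is [k]. *)
Lemma scale_incidence_gram : be *: (B *m B^T) = L + k%:M.
Proof.
have -> : B^T = fun_mx (fun (e : edge G) (v : G) => (v \in val e)%:R).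
  by apply/matrixP => i j; rewrite !mxE.
rewrite mul_fun_mx; apply/matrixP => i j; rewrite !mxE.
under eq_bigr => e _ do rewrite -natrM.
rewrite -natr_sum; have [<-|ne] := eqVneq i j.
  under eq_bigr => e _ do rewrite mulnb andbb.
  rewrite sum_edges_at regG adj_irrefl /k /be /tr !mulr1n /=.
  by ring.
by rewrite sum_common_edges ?(inj_eq enum_val_inj) // !mulr0n mulr0 add0r addr0.
Qed.

(** The diagonal of [B^T B] is 2, which accounts for the summand [2 * be] in [c]. *)
Lemma scale_line_gram :
  c%:M - be *: (B^T *m B)
    = fun_mx (fun e f : edge G => (x - al * (t.*2)%:R) *+ (e == f)
         - be * ((e != f) && (val e :&: val f != set0))%:R).
Proof.
have -> : B^T = fun_mx (fun (e : edge G) (v : G) => (v \in val e)%:R).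
  by apply/matrixP => i j; rewrite !mxE.
rewrite mul_fun_mx; apply/matrixP => i j; rewrite !mxE.
under eq_bigr => e _ do rewrite -natrM.
rewrite -natr_sum sum_edgeI card_edgeI natrD -(inj_eq enum_val_inj) /c /tr.
by case: eqP => _; rewrite -?muln2 ?natrM /=; ring.
Qed.

Definition join_class (u : J) : 'I_4 :=
  match u with
  | inl (inl _) => inord 0 | inl (inr _) => inord 1
  | inr (inl _) => inord 2 | inr (inr _) => inord 3
  end.

(** The degrees remain those of the whole join; only the complete joins between classes are left
    out. *)
Definition join_diag (u v : J) : R :=
  match u, v with
  | inl u', inl v' => (x - al * (degree u)%:R) *+ (u == v) - be * (adj u v)%:R
  | inr (inl i), inr (inl j) => p *+ (i == j)
  | inr (inr i), inr (inr j) => q *+ (i == j)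
  | _, _ => 0
  end.

(** The classes come in the order of [join_class]. The entry [- be] marks two classes that are
    completely joined. *)
Definition join_coupling : 'M[R]_4 := \matrix_(i, j) nth 0 (nth [::]
  [:: [:: 0; 0; - be; - be]; [:: 0; 0; 0; 0];
      [:: - be; 0; 0; - be]; [:: - be; 0; - be; 0]] i) j.

Definition join_quotient : 'M[R]_4 := \matrix_(i, j) nth 0 (nth [::]
  [:: [:: y - tr; - (be * tr); 0; 0]; [:: - (be * 2); c - be * 2 * tr; 0; 0];
      [:: 0; 0; p; 0]; [:: 0; 0; 0; q]] i) j.

Lemma sum_join_class (f : J -> R) (j : 'I_4) :
  \sum_(u | join_class u == j) f u
    = nth 0 [:: \sum_v f (inl (inl v)); \sum_e f (inl (inr e));
                \sum_i f (inr (inl i)); \sum_i f (inr (inr i))] j.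
Proof.
rewrite !big_sumType /= -!val_eqE /= !inordK //.
by case: j => -[|[|[|[|]]]] //= _; rewrite !big_pred0_eq !(addr0, add0r).
Qed.

Lemma sum_mulrn_eq (I : finType) (r : R) (i : I) : \sum_j r *+ (i == j) = r.
Proof.
by rewrite (bigD1 i) //= eqxx big1 ?addr0 // => j; rewrite eq_sym => /negPf->.
Qed.

Lemma sum_opp_mul_nat (I : finType) (r : R) (F : I -> nat) :
  \sum_i - (r * (F i)%:R) = - (r * (\sum_i F i)%:R).
Proof. by rewrite sumrN -mulr_sumr natr_sum. Qed.

Lemma join_diag_equitable u j :
  \sum_(v | join_class v == j) join_diag u v = join_quotient (join_class u) j.
Proof.
rewrite sum_join_class mxE; congr (nth 0 _ _).
case: u => [[v|e]|[i|i]]; rewrite /join_class inordK //= ?big_split /= !big1_eq.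
- rewrite (degree_join_vertex _ _ regG) !sum_opp_mul_nat sum_edges_at -degree_sum regG.
  rewrite add0r (sum_mulrn_eq _ v) /y /be /tr /N -addnn !natrD.
  by congr [:: _; _; _; _]; ring.
- rewrite (degree_join_edge _ _ regG) !sum_opp_mul_nat sum_edge.
  rewrite add0r (sum_mulrn_eq _ e); congr [:: _; _; _; _].
  (* [s] counts the edges meeting [e] in one vertex; the additive form avoids truncated
     subtraction. *)
  set s := (\sum_i _)%N; have eqs : (2 + s = t.*2)%N.
    rewrite -(sum_card_edgeI regG e); under [RHS]eq_bigr => f _ do rewrite card_edgeI.
    rewrite big_split /= [in RHS](bigD1 e) //= eqxx big1 ?addn0 // => f.
    by rewrite eq_sym => /negPf->.
  have -> : s%:R = t%:R * 2 - 2 :> R by rewrite -natrM muln2 -eqs natrD addrC addKr.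
  by rewrite -muln2 natrM /c /be /tr; ring.
- by rewrite sum_mulrn_eq.
- by rewrite sum_mulrn_eq.
Qed.

Lemma join_matrix_split u v :
  (x - al * (degree u)%:R) *+ (u == v) - be * (adj u v)%:R
    = join_diag u v + join_coupling (join_class u) (join_class v).
Proof.
rewrite mxE.
case: u => [[u|u]|[u|u]]; case: v => [[v|v]|[v|v]];
  rewrite /join_class /join_diag ?inordK //= ?addr0 //
    ?degree_join_left ?degree_join_right /=;
  by rewrite ?mulr0n ?mulr1 ?mulr0 ?oppr0 ?addr0 ?sub0r ?add0r // natrD.
Qed.

Lemma det_join_diag :
  \det (fun_mx join_diag)
    = \det (block_mx (y%:M - L) (- (be *: B)) (- (be *: B^T))
              (c%:M - be *: (B^T *m B))) * (p ^+ a * q ^+ b).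
Proof.
have fun_mx0 (T1 T2 : finType) : fun_mx (fun (_ : T1) (_ : T2) => 0 : R) = 0.
  by apply/matrixP => i j; rewrite !mxE.
rewrite det_fun_mx_sum /join_diag /= !fun_mx0 det_lblock; congr (_ * _); last first.
  rewrite det_fun_mx_sum /= !fun_mx0 det_lblock !det_fun_mx_scalar.
  by rewrite !card_ord.
rewrite det_fun_mx_sum; congr (\det (block_mx _ _ _ _)).
- apply/matrixP => i j; rewrite !mxE (degree_join_vertex _ _ regG) regG.
  rewrite [_ == _ :> J](inj_eq enum_val_inj) -addnn !natrD /y /tr /N natrD /be /=.
  by case: eqP => _; rewrite ?mulr1n ?mulr0n; ring.
- by apply/matrixP => i j; rewrite !mxE sub0r.
- by apply/matrixP => i j; rewrite !mxE sub0r.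
- rewrite scale_line_gram; apply: eq_fun_mx => e f.
  by rewrite (degree_join_edge _ _ regG).
Qed.

Lemma det_join_quotient :
  \det join_quotient = ((y - tr) * (c - 2 * be * tr) - 2 * be ^+ 2 * tr) * (p * q).
Proof.
rewrite /join_quotient (det_laplace _ (fun i j => nth 0 (nth [::] _ i) j)).
by rewrite /= !big_ord_recl !big_ord0 /bump /=; ring.
Qed.

(** The first factor is the determinant of the [T(G)] block of [join_quotient], and the next one
    that of the block of the two sides with their coupling; the subtracted term comes from joining
    [G] to the sides. *)
Definition join_quartic : R :=
  ((y - tr) * (c - 2 * be * tr) - 2 * be ^+ 2 * tr) * (p * q - be ^+ 2 * (a * b)%:R)
  - n%:R * be ^+ 2 * (c - 2 * be * tr)
    * ((x - al * n%:R) * N - al * N ^+ 2 + 2 * (a * b)%:R).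

Lemma det_join_coupled :
  \det (\matrix_(i, j) (join_quotient i j
      + join_coupling i j * #|[pred u | join_class u == j]|%:R)) = join_quartic.
Proof.
have -> : \matrix_(i, j) (join_quotient i j
      + join_coupling i j * #|[pred u | join_class u == j]|%:R)
  = \matrix_(i, j) nth 0 (nth [::]
      [:: [:: y - tr; - (be * tr); - (be * a%:R); - (be * b%:R)];
          [:: - (be * 2); c - be * 2 * tr; 0; 0];
          [:: - (be * n%:R); 0; p; - (be * b%:R)];
          [:: - (be * n%:R); 0; - (be * a%:R); q]] i) j.
  apply/matrixP => i j; rewrite !mxE -sum1_card natr_sum.
  rewrite (sum_join_class (fun=> 1)) !sumr_const !card_ord.
  case: i => -[|[|[|[|]]]] //= _; case: j => -[|[|[|[|]]]] //= _;
  by rewrite ?mul0r ?addr0 ?add0r ?mulNr.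
rewrite (det_laplace _ (fun i j => nth 0 (nth [::] _ i) j)).
rewrite /= !big_ord_recl !big_ord0 /bump /= /join_quartic /p /q /N natrD natrM.
by rewrite /be; ring.
Qed.

End JoinMatrix.

(** * The characteristic polynomial of the join *)

(** This puts the matrix left by eliminating the edge rows into the form that [sym_spectrum]
    evaluates. *)
Lemma scalar_quadratic_expand (R : comNzRingType) m (L : 'M[R]_m) (c y k z : R) :
  c *: (y%:M - L) - (L + k%:M) *m (z%:M - L)
    = (c * y - k * z)%:M + (k - c - z) *: L + 1 *: (L *m L).
Proof.
rewrite mulmxDl !mulmxBr !mul_scalar_mx mul_mx_scalar; set LL := L *m L.
apply/matrixP => i j; rewrite !mxE.
by case: eqP => _; rewrite ?mulr1n ?mulr0n; ring.
Qed.

Section JoinSpectrum.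
Variables (R : rcfType) (al : R) (G : sgraph) (t a b : nat).
Hypothesis al01 : 0 <= al <= 1.
Hypothesis regG : regular G t.
Hypothesis G_gt0 : (0 < #|G|)%N.
Hypotheses (a_gt0 : (0 < a)%N) (b_gt0 : (0 < b)%N).
Let J := tvjoin G (complete_bipartite a b).
Let L := Aalpha al G.
Let N : R := (a + b)%:R.
Let n : R := #|G|%:R.

Lemma tr_Aalpha (H : sgraph) : (Aalpha al H)^T = Aalpha al H.
Proof.
apply/matrixP => i j; rewrite !mxE adj_sym eq_sym.
by case: eqP => [->|].
Qed.

Lemma Aalpha_colsum j : \sum_i L i j = t%:R.
Proof.
under eq_bigr => i _ do rewrite !mxE regG adj_sym.
rewrite big_split -!mulr_sumr /= [X in al * X](_ : _ = t%:R); last first.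
  rewrite (bigD1 j) //= eqxx mulr1n big1 ?addr0 // => i ne.
  by rewrite (negPf ne).
rewrite (sum_enum_val (fun v => (adj (enum_val j) v)%:R)) -natr_sum -degree_sum regG.
by ring.
Qed.

Lemma eigenvalue_Aalpha : eigenvalue L t%:R.
Proof.
apply/eigenvalueP; exists (const_mx 1).
  apply/rowP => j; rewrite !mxE mulr1 -(Aalpha_colsum j).
  by apply: eq_bigr => i _; rewrite mxE mul1r.
by apply/rV0Pn; exists (Ordinal G_gt0); rewrite mxE oner_eq0.
Qed.

Lemma mem_spectrum k (A : 'M[R]_k) l :
  A^T = A -> (l \in spectrum A) = eigenvalue A l.
Proof.
move=> /sym_spectrum[_ charA _].
by rewrite eigenvalue_root_char charA root_prod_XsubC.
Qed.

(** The constant column sums [t] make [t] both an eigenvalue and an upper bound for all of them, so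
    it heads the sorted spectrum. *)
Lemma big_spectrum_eigval I (idx : I) (op : Monoid.com_law idx) (F : R -> I) :
  \big[op/idx]_(l <- spectrum L) F l
    = op (F t%:R) (\big[op/idx]_(i <- index_iota 2 #|G|.+1) F (eigval L i)).
Proof.
have [size_s _ _] := sym_spectrum (tr_Aalpha G).
have ge_total : total (fun x y : R => y <= x) by move=> x y; apply: le_total.
set s := sort (fun x y : R => y <= x) (spectrum L).
have perm_s : perm_eq s (spectrum L) by rewrite perm_sort.
have mem_s l : (l \in s) = eigenvalue L l.
  by rewrite (perm_mem perm_s) mem_spectrum ?tr_Aalpha.
have le_t l : l \in s -> l <= t%:R.
  rewrite mem_s; apply: eigenvalue_le_colsum; last exact: Aalpha_colsum.
  case/andP: al01 => al0 al1 i j; rewrite !mxE addr_ge0 // mulr_ge0 ?subr_ge0 //.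
  by case: eqP => _; rewrite ?ler0n.
have s_t : t%:R \in s by rewrite mem_s eigenvalue_Aalpha.
have size_sG : size s = #|G| by rewrite (perm_size perm_s).
rewrite -(perm_big _ perm_s) /eigval -/s -/L.
have : sorted (fun x y : R => y <= x) s by apply: sort_sorted.
case: s s_t le_t size_sG {perm_s mem_s} => // x r x_t le_t sz.
move=> /= /(order_path_min (fun y x z xy yz => le_trans yz xy))/allP le_x.
have -> : x = t%:R.
  apply/le_anti; rewrite le_t ?mem_head //=.
  by move: x_t; rewrite inE => /orP[/eqP->//|/le_x].
rewrite big_cons; congr (op _ _); rewrite (big_nth 0).
rewrite -[X in _ = \big[_/_]_(i <- index_iota _ X.+1) _]sz.
(* [eigval L i] reads position [i - 1] of the sorted list, so position 0 of the tail [r] corresponds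
   to [i = 2]. *)
rewrite -[2%N]/(0 + 2)%N big_addn subSS subn1 /=.
by apply: eq_bigr => i _; rewrite addn2.
Qed.

(** The factor that an eigenvalue [l] of [L] contributes to the determinant left after eliminating
    the edge rows. *)
Definition quad_poly (l : R) : {poly R} :=
  'X^2 - (al * (t%:R + N + 2) + t%:R - 2 + 2 * l)%:P * 'X
  + ((al * t%:R + al * N + l) * (t%:R - 2 + 2 * al + l)
     - (1 - al) * (t%:R - 2 * al * t%:R + l))%:P.

Definition edge_root : R := 2 * al * (t%:R + 1) - 2.
Definition left_root : R := al * (n + b%:R).
Definition right_root : R := al * (n + a%:R).

Definition quartic_poly : {poly R} :=
  ('X^2 - (al * t%:R + al * N + 3 * t%:R - 2 + 2 * al)%:P * 'X
   + (2 * al ^+ 2 * N + 2 * al * t%:R ^+ 2 + 2 * al * t%:R * N + 4 * al * t%:R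
      - 2 * al * N + 2 * t%:R ^+ 2 - 4 * t%:R)%:P)
  * ('X^2 - (2 * al * n + al * N)%:P * 'X
     + (al ^+ 2 * n ^+ 2 + al ^+ 2 * n * N + 2 * al * (a * b)%:R - (a * b)%:R)%:P)
  - (n * (1 - al) ^+ 2)%:P * (('X + (2 - 2 * t%:R - 2 * al)%:P)
    * (N%:P * 'X + (2 * (a * b)%:R - al * N ^+ 2 - al * n * N)%:P)).

Lemma size_linear_leq (u v : R) : (size (u%:P * 'X + v%:P)%R <= 2)%N.
Proof. by rewrite size_MXaddC size_polyC; case: ifP => //; case: (u != 0). Qed.

Lemma size_monic_quadratic (u v : R) : size ('X^2 - u%:P * 'X + v%:P) = 3%N.
Proof.
by rewrite -addrA -mulNr -polyCN size_polyDl size_polyXn // ltnS size_linear_leq.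
Qed.

Lemma monic_quadratic_neq0 (u v : R) : 'X^2 - u%:P * 'X + v%:P != 0.
Proof. by rewrite -size_poly_eq0 size_monic_quadratic. Qed.

(** The product of the two monic quadratics has degree 4 and the subtracted term has degree at most
    2. *)
Lemma size_quartic_poly : size quartic_poly = 5%N.
Proof.
rewrite /quartic_poly size_polyDl size_mul ?monic_quadratic_neq0 ?size_monic_quadratic //.
rewrite size_polyN ltnS mul_polyC; apply: leq_trans (size_scale_leq _ _) _.
apply: leq_trans (size_polyMleq _ _) _; rewrite size_XaddC /=.
by apply: leq_trans (size_linear_leq _ _) _.
Qed.

(* The extra factors on the left avoid dividing by determinants that may vanish;
   being nonzero polynomials, they cancel afterwards. *)
Lemma char_poly_join :
  char_poly (Aalpha al J) * quad_poly t%:R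
    * (('X - left_root%:P) * ('X - right_root%:P)) * ('X - edge_root%:P) ^+ #|G|
  = (\prod_(l <- spectrum L) quad_poly l) * ('X - edge_root%:P) ^+ #|edge G|
    * (('X - left_root%:P) ^+ a * ('X - right_root%:P) ^+ b) * quartic_poly.
Proof.
apply: poly_ext => x; rewrite !hornerM horner_char_poly.
rewrite scalar_sub_Aalpha (eq_fun_mx (@join_matrix_split R al x G a b)).
have := det_equitable (join_coupling al) (@join_diag_equitable R al x G t a b regG).
rewrite det_join_coupled det_join_quotient (det_join_diag _ _ _ _ regG).
(* Eliminate the edge rows in the block of [T(G)]; the scalar left on the edges is
   [x - edge_root]. *)
have := det_incidence_block L (fun_mx (fun (v : G) (e : edge G) => (v \in val e)%:R))
  (1 - al) (x - 2 * al * t%:R + 2 * (1 - al)) (x - al * (t%:R + N)).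
rewrite (scale_incidence_gram _ regG) -/L.
set X := \det (block_mx _ _ _ _); set CH := \det (fun_mx _).
have -> : x - 2 * al * t%:R + 2 * (1 - al) = x - edge_root by rewrite /edge_root; ring.
have [_ _ detL] := sym_spectrum (tr_Aalpha G).
rewrite scalar_quadratic_expand detL.
move=> eqX eqCH.
rewrite !horner_exp horner_prod !hornerXsubC.
set c := x - edge_root in eqX eqCH *.
set p := x - left_root; set q := x - right_root.
have quad_x l : (quad_poly l).[x] = (c * (x - al * (t%:R + N))
     - (1 - 2 * al) * t%:R * (1 - al + (x - al * (t%:R + N))))
     + ((1 - 2 * al) * t%:R - c - (1 - al + (x - al * (t%:R + N)))) * l
     + 1 * l ^+ 2.
  rewrite /quad_poly !(hornerD, hornerN, hornerM, hornerXn, hornerX, hornerC).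
  by rewrite /c /edge_root; ring.
have quartic_x : quartic_poly.[x] = join_quartic al x G t a b.
  rewrite /quartic_poly !(hornerD, hornerN, hornerM, hornerXn, hornerX, hornerC).
  rewrite /join_quartic -/n -/N.
  by rewrite /N natrD natrM; ring.
rewrite quartic_x (eq_bigr _ (fun l _ => quad_x l)).
(* At [l = t] the quadratic is the [T(G)] factor of [\det join_quotient], which is why these two
   will cancel. *)
rewrite (_ : (quad_poly t%:R).[x] = (x - al * (t%:R + (a + b)%:R) - t%:R)
    * (c - 2 * (1 - al) * t%:R) - 2 * (1 - al) ^+ 2 * t%:R); last first.
  by rewrite quad_x /c /edge_root /N; ring.
rewrite -[CH * _ * _]mulrA [CH * _]eqCH -!(mulrAC _ (c ^+ #|G|)) eqX.
by rewrite -!mulrA.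
Qed.

Let neq0 : quad_poly t%:R * (('X - left_root%:P) * ('X - right_root%:P)) != 0.
Proof. by rewrite !mulf_neq0 ?monic_quadratic_neq0 ?polyXsubC_eq0. Qed.

Let split_exp (P : {poly R}) k : (0 < k)%N -> P ^+ k = P * P ^+ (k - 1).
Proof. by case: k => // k _; rewrite subn1 exprS. Qed.

(** For [t >= 2] the handshake identity gives at least as many edges as vertices, so the surplus
    power of ['X - edge_root%:P] stays on the right. *)
Lemma char_poly_join_ge2 : (2 <= t)%N ->
  char_poly (Aalpha al J)
    = ('X - edge_root%:P) ^+ (#|edges G| - #|G|)
      * (('X - right_root%:P) ^+ (b - 1) * (('X - left_root%:P) ^+ (a - 1)
      * ((\prod_(i <- index_iota 2 #|G|.+1) quad_poly (eigval L i))
         * quartic_poly))).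
Proof.
move=> t_ge2; have le_nm : (#|G| <= #|edges G|)%N.
  rewrite -leq_double -(handshake regG) -muln2; exact: leq_mul.
have nz : ('X - edge_root%:P) ^+ #|G| != 0 by rewrite expf_neq0 ?polyXsubC_eq0.
apply: (mulIf neq0); apply: (mulIf nz).
have := char_poly_join; rewrite big_spectrum_eigval card_edges -{1}(subnK le_nm) exprD.
rewrite [in X in X -> _](split_exp _ a_gt0) [in X in X -> _](split_exp _ b_gt0).
move: (char_poly _) (quad_poly _) (\prod_(_ <- _) _) quartic_poly => ch qt qs qu.
move: (_ ^+ (b - 1)) (_ ^+ (a - 1)) (_ ^+ (_ - _)) (_ ^+ #|G|) => rb la em en.
move: ('X - left_root%:P) ('X - right_root%:P) => l r eq_ch.
by transitivity (ch * qt * (l * r) * en); [ring | rewrite eq_ch /=; ring].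
Qed.

(** Here [G] has two vertices and one edge, so one factor ['X - edge_root%:P] too many stands on the
    left. It cancels against the quadratic at the second eigenvalue, whose other root is the simple
    eigenvalue. *)
Lemma char_poly_join_matching : t = 1%N -> #|G| = 2%N ->
  char_poly (Aalpha al J)
    = ('X - (al * (3 + N) - 1)%:P)
      * (('X - right_root%:P) ^+ (b - 1) * (('X - left_root%:P) ^+ (a - 1)
      * quartic_poly)).
Proof.
move=> t1 n2; have m1 : #|edges G| = 1%N.
  by apply: double_inj; rewrite -(handshake regG) t1 n2.
have nz : ('X - edge_root%:P) ^+ #|G| != 0 by rewrite expf_neq0 ?polyXsubC_eq0.
apply: (mulIf neq0); apply: (mulIf nz).
have [size_s charL _] := sym_spectrum (tr_Aalpha G).
have iota2 : index_iota 2 #|G|.+1 = [:: 2%N] by rewrite n2.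
(* The two eigenvalues of [L] sum to its trace [2 * al], and the larger one is 1. *)
have eig2 : eigval L 2 = 2 * al - 1.
  have trL : \tr L = \sum_(l <- spectrum L) l.
    apply: oppr_inj; rewrite -char_poly_trace // charL.
    have /coefPn_prod_XsubC <- : size (spectrum L) != 0%N by rewrite size_s -lt0n.
    by rewrite [size (spectrum L)]size_s.
  have tr2 : \tr L = al *+ 2.
    rewrite -[in RHS]n2 -[in RHS](card_ord #|G|) -sumr_const; apply: eq_bigr => i _.
    by rewrite !mxE eqxx adj_irrefl regG t1 !mulr1n mulr1 mulr0 addr0.
  move: trL; rewrite tr2 big_spectrum_eigval iota2 big_seq1 t1 /= => eq2.
  by apply: (addrI 1); rewrite -eq2; ring.
have quad2 : quad_poly (2 * al - 1)
    = ('X - edge_root%:P) * ('X - (al * (3 + N) - 1)%:P).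
  apply: poly_ext => x; rewrite /quad_poly /edge_root t1.
  by rewrite !(hornerD, hornerN, hornerM, hornerXn, hornerX, hornerC); ring.
have := char_poly_join; rewrite big_spectrum_eigval card_edges m1 iota2 big_seq1 eig2 quad2.
rewrite [in X in X -> _](split_exp _ a_gt0) [in X in X -> _](split_exp _ b_gt0).
move: (char_poly _) (quad_poly _) quartic_poly => ch qt qu.
move: (_ ^+ (b - 1)) (_ ^+ (a - 1)) => rb la.
move: ('X - left_root%:P) ('X - right_root%:P) ('X - edge_root%:P) => l r e.
have -> : e ^+ #|G| = e ^+ 2 by rewrite n2.
move: ('X - _%:P) => f eq_ch.
by transitivity (ch * qt * (l * r) * e ^+ 2); [ring | rewrite eq_ch /=; ring].
Qed.

(** The characteristic polynomial of a symmetric matrix splits over [R], hence so does every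
    divisor. *)
Lemma size_root_multiset_quartic :
  quartic_poly %| char_poly (Aalpha al J) -> size (root_multiset quartic_poly) = 4%N.
Proof.
have [_ -> _] := sym_spectrum (tr_Aalpha J).
by move/size_root_multiset_dvdp; rewrite size_quartic_poly.
Qed.

End JoinSpectrum.

(** * Reading the spectrum off the factorization *)

Theorem corollary5p2 (R : rcfType) (alpha : R) (G1 : sgraph)
    (t1 n1 m1 a b n2 : nat)
    (halpha : 0 <= alpha <= 1)
    (hreg : regular G1 t1) (hn1 : #|G1| = n1) (hm1 : #|edges G1| = m1)
    (n1_gt0 : (0 < n1)%N)
    (a_gt0 : (0 < a)%N) (b_gt0 : (0 < b)%N) (hn2 : n2 = (a + b)%N) :
  let al := alpha%:P in
  let t := t1%:R : {poly R} in
  let n := n1%:R : {poly R} in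
  let N := n2%:R : {poly R} in
  let ab := (a * b)%:R : {poly R} in
  let spec := spectrum (Aalpha alpha (tvjoin G1 (complete_bipartite a b))) in
  (* n1 = 2 is forced by the count 3 + n2 of the eigenvalues listed here *)
  (t1 = 1%N -> n1 = 2%N ->
    let quartic : {poly R} :=
      ('X^2 - (3 * al + al * N + 1) * 'X + (2 * al ^+ 2 * N + 6 * al - 2))
      * ('X^2 - (4 * al + al * N) * 'X
         + (4 * al ^+ 2 + 2 * al ^+ 2 * N + 2 * al * ab - ab))
      - 2 * (1 - al) ^+ 2 * ('X - 2 * al)
        * (('X - 2 * al) * N - al * N ^+ 2 + 2 * ab) in
    size (root_multiset quartic) = 4%N
    /\ perm_eq spec
         ([:: alpha * (3 + n2%:R) - 1]
          ++ nseq (b - 1) (alpha * (2 + a%:R))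
          ++ nseq (a - 1) (alpha * (2 + b%:R))
          ++ root_multiset quartic))
  /\
  ((2 <= t1)%N ->
    let quadratic (i : nat) : {poly R} :=
      let l := (eigval (Aalpha alpha G1) i)%:P in
      'X^2 - (al * (t + N + 2) + t - 2 + 2 * l) * 'X
      - (1 - al) * (t - 2 * al * t + l)
      + (al * t + al * N + l) * (t - 2 + 2 * al + l) in
    let quartic : {poly R} :=
      ('X^2 - (al * t + al * N + 3 * t - 2 + 2 * al) * 'X
       + (2 * al ^+ 2 * N + 2 * al * t ^+ 2 + 2 * al * t * N + 4 * al * t
          - 2 * al * N + 2 * t ^+ 2 - 4 * t))
      * ('X^2 - (2 * al * n + al * N) * 'X
         + (al ^+ 2 * n ^+ 2 + al ^+ 2 * n * N + 2 * al * ab - ab))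
      - n * (1 - al) ^+ 2 * ('X + 2 - 2 * t - 2 * al)
        * (('X - al * n) * N - al * N ^+ 2 + 2 * ab) in
    size (root_multiset quartic) = 4%N
    /\ perm_eq spec
         (nseq (m1 - n1) (2 * alpha * (t1%:R + 1) - 2)
          ++ nseq (b - 1) (alpha * (n1%:R + a%:R))
          ++ nseq (a - 1) (alpha * (n1%:R + b%:R))
          ++ flatten [seq root_multiset (quadratic i)
                     | i <- index_iota 2 n1.+1]
          ++ root_multiset quartic)).
Proof.
move=> al t n N ab spec.
have natC k : k%:R = (k%:R : R)%:P by rewrite rmorph_nat.
have quarticE : quartic_poly alpha G1 t1 a b
  = ('X^2 - (al * t + al * N + 3 * t - 2 + 2 * al) * 'X
       + (2 * al ^+ 2 * N + 2 * al * t ^+ 2 + 2 * al * t * N + 4 * al * t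
          - 2 * al * N + 2 * t ^+ 2 - 4 * t))
      * ('X^2 - (2 * al * n + al * N) * 'X
         + (al ^+ 2 * n ^+ 2 + al ^+ 2 * n * N + 2 * al * ab - ab))
      - n * (1 - al) ^+ 2 * ('X + 2 - 2 * t - 2 * al)
        * (('X - al * n) * N - al * N ^+ 2 + 2 * ab).
  rewrite /quartic_poly /t /n /N /ab /al hn1 -hn2 !natC -polyC1.
  (* Evaluation moves the identity from [{poly R}] to [R], where the constant polynomials become
     plain coefficients. *)
  apply: poly_ext => x.
  rewrite !(hornerD, hornerN, hornerM, horner_exp, hornerX, hornerC).
  by ring.
have quartic0 : quartic_poly alpha G1 t1 a b != 0.
  by rewrite -size_poly_eq0 size_quartic_poly.
have G1_gt0 : (0 < #|G1|)%N by rewrite hn1.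
split=> [t1E n1E quartic|t_ge2 quadratic quartic].
  have -> : quartic = quartic_poly alpha G1 t1 a b.
    by rewrite quarticE /quartic /t /n t1E n1E; ring.
  have charE := char_poly_join_matching halpha hreg G1_gt0 a_gt0 b_gt0 t1E
    (etrans hn1 n1E).
  split; first by apply: size_root_multiset_quartic; rewrite charE !mulrA dvdp_mulIr.
  (* As a first power, the simple factor can be split off by the same lemma as the other two. *)
  rewrite /spec /spectrum charE -(expr1 ('X - _%:P)) hn2.
  (* The 2 in the listed eigenvalues is the order of [G1], as it occurs in [left_root] and
     [right_root]. *)
  have -> : 2 = #|G1|%:R :> R by rewrite hn1 n1E.
  do 3![apply: root_multiset_XsubC_expM;
    first by rewrite ?mulf_neq0 ?expf_neq0 ?polyXsubC_eq0].
  exact: perm_refl.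
have quadE i : quadratic i = quad_poly alpha t1 a b (eigval (Aalpha alpha G1) i).
  rewrite /quadratic /quad_poly /t /N /al -hn2 !natC.
  apply: poly_ext => x.
  by rewrite !(hornerD, hornerN, hornerM, horner_exp, hornerX, hornerC); ring.
rewrite /quartic -quarticE.
have charE := char_poly_join_ge2 halpha hreg G1_gt0 a_gt0 b_gt0 t_ge2.
split; first by apply: size_root_multiset_quartic; rewrite charE !mulrA dvdp_mulIr.
have quad0 l : quad_poly alpha t1 a b l != 0 by apply: monic_quadratic_neq0.
have prod0 : \prod_(i <- index_iota 2 #|G1|.+1)
    quad_poly alpha t1 a b (eigval (Aalpha alpha G1) i) != 0.
  by rewrite prodf_seq_neq0; apply/allP => i _; rewrite quad0.
rewrite /spec /spectrum charE -hm1 -hn1.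
rewrite (eq_map (fun i => congr1 (@root_multiset R) (quadE i))).
do 3![apply: root_multiset_XsubC_expM;
  first by rewrite ?mulf_neq0 ?expf_neq0 ?polyXsubC_eq0].
apply: perm_trans (root_multisetM _ _) _ => //.
by rewrite perm_cat2r; apply: root_multiset_prod.
Qed.
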